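(* Let $F$ be an algebraically closed field and let $k$ be a field of transcendence degree one over $F$, equipped with an involution $\lambda\mapsto\bar\lambda$ (a field automorphism of $k$ of order $\le 2$) which is the identity on $F$; assume that the involution is not the identity on $k$, or else that $\operatorname{char} k\neq 2$. Let $V$ be a finite-dimensional vector space over $k$ and let $(\ ,\ ):V\times V\to k$ be a hermitian form. If $\dim V\ge 3$, then $V$ contains a non-zero isotropic element, i.e. there exists $v\in V$, $v\neq 0$, with $(v,v)=0$.
   Context: An involution of a field $k$ is a field automorphism $\lambda\mapsto\bar\lambda$ of order $\le 2$ (the identity is allowed). A map $(\ ,\ ):V\times V\to k$ is a hermitian form if it is linear in the first variable and $\overline{(v,w)}=(w,v)$ for all $v,w\in V$ (no nondegeneracy or positivity is required; if the involution is the identity, this is a symmetric bilinear form). An element $v\in V$ is isotropic if $(v,v)=0$. *)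

(* Defs.v *)
From HB Require Import structures.
From mathcomp Require Import all_boot all_order all_algebra.

Set Implicit Arguments.
Unset Strict Implicit.
Unset Printing Implicit Defensive.

Import GRing.Theory.
Local Open Scope ring_scope.

(* An extension k of F is given by its embedding iota : F -> k. *)

(* y lies in F(t), the subfield of k generated by iota(F) and t. *)
Definition in_adjoin (F k : fieldType) (iota : {rmorphism F -> k}) (t y : k) :
    Prop :=
  exists a b : {poly F},
    (map_poly iota b).[t] != 0 /\
    y = (map_poly iota a).[t] / (map_poly iota b).[t].

Definition algebraic_over_adjoin (F k : fieldType) (iota : {rmorphism F -> k})
    (t x : k) : Prop :=
  exists p : {poly k},
    [/\ p != 0, forall i, in_adjoin iota t p`_i & root p x].

(* There is a transcendence basis {t} with one element: t is transcendental
   over F and k is algebraic over F(t).  No finite generation is required. *)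
Definition transcendence_degree_one (F k : fieldType)
    (iota : {rmorphism F -> k}) : Prop :=
  exists t : k,
    ~ algebraicOver iota t /\ forall x : k, algebraic_over_adjoin iota t x.

(* Main.v *)
(* Let e_1, e_2, e_3 be independent vectors of V, let h be the Gram matrix of the
   form on them, and let U_n be the F-span of the products of n elements of the
   set {1} u {h_ij}.  Each U_n is stable under the involution, so for a_i in U_n
   the value (v, v) at v = sum a_i e_i lies in U_(2n+1); in F-coordinates this is
   a system of dim U_(2n+1) quadratic equations in 3 dim U_n unknowns in F.
   Since k has transcendence degree one, dim U_n is at most linear in n, so
   3 dim U_n <= dim U_(2n+1) cannot hold for all n = 2^j - 1: some system has
   more unknowns than equations.

   Over F algebraically closed, r quadratic forms f_l in s > r variables have a
   common non-trivial zero.  In K = F(x_1, ..., x_s), suppose that sending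
   every f_l / x_i^2 to 0 gives a well-defined F-algebra morphism
   F[f_1 / x_i^2, ..., f_r / x_i^2] -> F.  Extend it until its domain contains
   all ratios x_k / x_j for some j; the images of the x_k / x_j form a common
   zero whose j-th coordinate is 1.  If the morphism is ill-defined for every i,
   then every x_i is integral over F[f_1, ..., f_r], and counting monomials
   contradicts s > r. *)
Require Import Defs.
From HB Require Import structures.
From mathcomp Require Import all_boot all_order all_algebra.
From mathcomp Require Import mpoly ring.
From Stdlib Require Import Classical.

Set Implicit Arguments.
Unset Strict Implicit.
Unset Printing Implicit Defensive.

Import GRing.Theory.
Local Open Scope ring_scope.

(** * Linear spans over F and growth of integral extensions *)

Section LinearSpan.
Variables (F K : fieldType) (iota : {rmorphism F -> K}).

(** An inductive span accepts any predicate as generating set and lets [F] act through [iota]. *)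
Inductive lspan (G : K -> Prop) : K -> Prop :=
| lspan0 : lspan G 0
| lspan_cons c x y : G x -> lspan G y -> lspan G (iota c * x + y).

Definition indep (I : finType) (e : I -> K) : Prop :=
  forall c : I -> F, \sum_i iota (c i) * e i = 0 -> forall i, c i = 0.

Lemma lspan_gen (G : K -> Prop) x : G x -> lspan G x.
Proof.
by move=> Gx; rewrite -[x]addr0 -[x]mul1r -(rmorph1 iota); apply: lspan_cons => //; left.
Qed.

Lemma lspanD (G : K -> Prop) x y : lspan G x -> lspan G y -> lspan G (x + y).
Proof.
move=> Gx Gy; elim: Gx => [|c u v Gu _ IH]; first by rewrite add0r.
by rewrite -addrA; apply: lspan_cons.
Qed.

Lemma lspanZ (G : K -> Prop) c x : lspan G x -> lspan G (iota c * x).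
Proof.
elim=> [|d u v Gu _ IH]; first by rewrite mulr0; left.
by rewrite mulrDr mulrA -rmorphM; apply: lspan_cons.
Qed.

Lemma lspanN (G : K -> Prop) x : lspan G x -> lspan G (- x).
Proof. by move/(lspanZ (- 1)); rewrite rmorphN rmorph1 mulN1r. Qed.

Lemma lspan_sum (G : K -> Prop) (I : Type) (r : seq I) (P : pred I) (f : I -> K) :
  (forall i, P i -> lspan G (f i)) -> lspan G (\sum_(i <- r | P i) f i).
Proof. by move=> Gf; apply: big_ind => //; [left | move=> ? ?; apply: lspanD]. Qed.

Lemma lspan_trans (G H : K -> Prop) x :
  (forall y, G y -> lspan H y) -> lspan G x -> lspan H x.
Proof.
move=> GH; elim=> [|c u v Gu _ IH]; first by left.
by apply: lspanD => //; apply/lspanZ/GH.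
Qed.

Lemma lspanMr (G H : K -> Prop) x z :
  (forall y, G y -> lspan H (y * z)) -> lspan G x -> lspan H (x * z).
Proof.
move=> GH; elim=> [|c u v Gu _ IH]; first by rewrite mul0r; left.
by rewrite mulrDl -mulrA; apply: lspanD => //; apply/lspanZ/GH.
Qed.

Lemma lspanM (G1 G2 H : K -> Prop) x y :
    (forall u v, G1 u -> G2 v -> lspan H (u * v)) ->
  lspan G1 x -> lspan G2 y -> lspan H (x * y).
Proof.
move=> GH Gx Gy; apply: lspanMr Gx => u Gu; rewrite mulrC.
by apply: lspanMr Gy => v Gv; rewrite mulrC; apply: GH.
Qed.

Lemma lspan_finite (I : finType) (w : I -> K) x :
    lspan (fun y => exists i, y = w i) x ->
  exists c : I -> F, x = \sum_i iota (c i) * w i.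
Proof.
elim=> [|c _ v [i ->] _ [d ->]].
  by exists (fun=> 0); rewrite big1 // => i _; rewrite rmorph0 mul0r.
exists (fun j => (if j == i then c else 0) + d j).
rewrite [in RHS](bigD1 i) //= [in LHS](bigD1 i) //= eqxx addrA rmorphD mulrDl; congr (_ + _).
by apply: eq_bigr => j /negPf ->; rewrite add0r.
Qed.

(** With more rows than columns, the coordinate matrix has a non-zero left kernel vector, which is a
    relation among the [e i]. *)
Lemma indep_leq_card (I J : finType) (e : I -> K) (w : J -> K) :
    indep e -> (forall i, lspan (fun y => exists j, y = w j) (e i)) ->
  (#|I| <= #|J|)%N.
Proof.
move=> inde ew; rewrite leqNgt; apply/negP => ltJI.
have [c cE] := fin_all_exists (fun i => lspan_finite (ew i)).
pose M : 'M[F]_(#|I|, #|J|) := \matrix_(i, j) c (enum_val i) (enum_val j).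
have kM0 : kermx M != 0.
  rewrite -mxrank_eq0 mxrank_ker subn_eq0 -ltnNge.
  exact: leq_ltn_trans (rank_leq_col M) ltJI.
have /rowV0Pn[u /sub_kermxP uM u0] := kM0.
case/negP: u0; apply/eqP/rowP => i; rewrite mxE -[i]enum_valK.
apply: (inde (fun i => u 0 (enum_rank i))).
under eq_bigr => j _ do rewrite cE mulr_sumr.
rewrite exchange_big big1 //= => j _.
under eq_bigr => k _ do rewrite mulrA -rmorphM.
rewrite -mulr_suml -rmorph_sum.
suff -> : \sum_k u 0 (enum_rank k) * c k j = 0 by rewrite rmorph0 mul0r.
have := congr1 (fun A : 'rV_#|J| => A 0 (enum_rank j)) uM; rewrite !mxE => uMj; rewrite -[RHS]uMj.
rewrite (reindex (@enum_val I I)); last exact: onW_bij (enum_val_bij I).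
by apply: eq_bigr => k _; rewrite mxE enum_valK enum_rankK.
Qed.

Section Growth.
Variables (I J : finType) (y : I -> K) (z : J -> K) (E D : I -> nat).
Hypothesis y_integral : forall i,
  lspan (fun x => exists a : J -> nat, exists j,
    [/\ forall l, (a l <= D i)%N, (j < E i)%N
      & x = (\prod_l z l ^+ a l) * y i ^+ j]) (y i ^+ E i).
Hypothesis E_gt0 : forall i, (0 < E i)%N.

Let d := \max_i D i.
(** Normal forms for words of length [n] in the [y i]: each letter costs at most [d] in every
    exponent of the [z l]. *)
Let R n := lspan (fun x => exists a : J -> nat, exists g : I -> nat,
  [/\ forall l, (a l <= n * d)%N, forall i, (g i < E i)%N
    & x = (\prod_l z l ^+ a l) * \prod_i y i ^+ g i]).

Let R_mulr n i x : R n x -> R n.+1 (x * y i).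
Proof.
apply: lspanMr => _ [a [g [le_a lt_g ->]]].
have [lt_gi|le_Eg] := ltnP (g i).+1 (E i).
  apply: lspan_gen; exists a, (fun k => if k == i then (g i).+1 else g k); split.
  - by move=> l; rewrite mulSn (leq_trans (le_a l)) ?leq_addl.
  - by move=> k; case: eqP => [->|].
  rewrite -mulrA; congr (_ * _); rewrite (bigD1 i) //= mulrAC -exprSr.
  rewrite [in RHS](bigD1 i) //= eqxx; congr (_ * _).
  by apply: eq_bigr => k /negPf ->.
(* The exponent reaches [E i]: [y_integral] replaces the power, raising each exponent of [z] by at
   most [D i <= d]. *)
have eE : (g i).+1 = E i by apply/eqP; rewrite eqn_leq lt_g.
rewrite (bigD1 i) //= mulrCA -!mulrA mulrC -!mulrA -exprS eE mulrC -mulrA.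
rewrite mulrCA; apply: lspanMr (y_integral i) => _ [b [j [le_b lt_j ->]]].
apply: lspan_gen; exists (fun l => (b l + a l)%N), (fun k => if k == i then j else g k).
split.
- by move=> l; rewrite mulSn leq_add // (leq_trans (le_b l)) ?leq_bigmax.
- by move=> k; case: eqP => [->|].
have -> : \prod_l z l ^+ (b l + a l) = (\prod_l z l ^+ b l) * \prod_l z l ^+ a l.
  by rewrite -big_split; apply: eq_bigr => l _; rewrite exprD.
rewrite [in RHS](bigD1 i) //= eqxx.
have -> : \prod_(k | k != i) y k ^+ (if k == i then j else g k)
        = \prod_(k | k != i) y k ^+ g k by apply: eq_bigr => k /negPf ->.
ring.
Qed.

Let R_word (s : seq I) : R (size s) (\prod_(i <- s) y i).
Proof.
elim: s => [|i s IH] /=; last by rewrite big_cons mulrC; apply: R_mulr.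
rewrite big_nil; apply: lspan_gen; exists (fun=> 0%N), (fun=> 0%N); split=> //.
by rewrite !big1 ?mul1r.
Qed.

(** Words of length at most [n] lie in the span of normal forms. The exponents of [z] give a
    polynomial of degree [#|J|] in [n], those of [y] only the constant [C]. *)
Lemma indep_growth : exists C d' : nat, forall n (N : finType) (e : N -> K), indep e ->
    (forall i, lspan (fun x => exists2 s : seq I, (size s <= n)%N &
       x = \prod_(i <- s) y i) (e i)) ->
  (#|N| <= (n * d').+1 ^ #|J| * C)%N.
Proof.
pose Em := \max_i E i.
exists (Em ^ #|I|)%N, d => n N e inde eW.
rewrite -[X in (X ^ #|J|)%N]card_ord -[X in (_ * X ^ _)%N]card_ord -!card_ffun -card_prod.
pose w (p : {ffun J -> 'I_(n * d).+1} * {ffun I -> 'I_Em}) :=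
  (\prod_l z l ^+ p.1 l) * \prod_i y i ^+ p.2 i.
apply: (indep_leq_card (w := w) inde) => i.
apply: lspan_trans (eW i) => _ [s le_s ->]; apply: lspan_trans (R_word s).
move=> _ [a [g [le_a lt_g ->]]]; apply: lspan_gen.
have lt_a l : (a l < (n * d).+1)%N.
  by rewrite ltnS (leq_trans (le_a l)) // leq_mul2r le_s orbT.
have lt_g' k : (g k < Em)%N by rewrite (leq_trans (lt_g k)) ?leq_bigmax.
exists ([ffun l => Ordinal (lt_a l)], [ffun k => Ordinal (lt_g' k)]).
by rewrite /w; congr (_ * _); apply: eq_bigr => l _; rewrite ffunE.
Qed.

End Growth.
End LinearSpan.

(** * Extension of places *)

Section Places.
Variables (F : closedFieldType) (K : fieldType) (iota : {rmorphism F -> K}).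

(* [S] is the graph of an F-algebra morphism from a subalgebra of K to F. *)
Record partial_place (S : K -> F -> Prop) : Prop := PartialPlace {
  place_const : forall c, S (iota c) c;
  placeD : forall u v a b, S u a -> S v b -> S (u + v) (a + b);
  placeM : forall u v a b, S u a -> S v b -> S (u * v) (a * b);
  place_functional : forall a, S 0 a -> a = 0 }.

Lemma place0 S : partial_place S -> S 0 0.
Proof. by move=> pS; rewrite -{1}(rmorph0 iota); apply: place_const. Qed.

Lemma place1 S : partial_place S -> S 1 1.
Proof. by move=> pS; rewrite -{1}(rmorph1 iota); apply: place_const. Qed.

Lemma placeB S u v a b : partial_place S -> S u a -> S v b -> S (u - v) (a - b).
Proof.
move=> pS Su Sv; apply: (placeD pS) => //; rewrite -mulN1r -[- b]mulN1r.
by apply: (placeM pS) => //; rewrite -(rmorph1 iota) -rmorphN; apply: place_const.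
Qed.

Lemma place_sum S (I : Type) (r : seq I) (u : I -> K) (a : I -> F) :
    partial_place S -> (forall i, S (u i) (a i)) ->
  S (\sum_(i <- r) u i) (\sum_(i <- r) a i).
Proof.
move=> pS Sua; apply: big_ind2 => //; first exact: place0.
by move=> ? ? ? ?; apply: placeD.
Qed.

(** [Q] is the reduction of [P] modulo the kernel, expressed through the graph [S]. *)
Definition place_lift (S : K -> F -> Prop) (P : {poly K}) (Q : {poly F}) : Prop :=
  forall i, S P`_i Q`_i.

Lemma place_liftD S P Q P' Q' : partial_place S ->
  place_lift S P Q -> place_lift S P' Q' -> place_lift S (P + P') (Q + Q').
Proof. by move=> pS SP SP' i; rewrite !coefD; apply: placeD. Qed.

Lemma place_liftM S P Q P' Q' : partial_place S ->
  place_lift S P Q -> place_lift S P' Q' -> place_lift S (P * P') (Q * Q').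
Proof.
by move=> pS SP SP' i; rewrite !coefM; apply: place_sum => // j; apply: placeM.
Qed.

Lemma place_lift_map S Q : partial_place S -> place_lift S (map_poly iota Q) Q.
Proof. by move=> pS i; rewrite coef_map; apply: place_const. Qed.

Lemma place_liftC S u a : partial_place S -> S u a -> place_lift S u%:P a%:P.
Proof. by move=> pS Su i; rewrite !coefC; case: eqP => // _; apply: place0. Qed.

(* The kernel of the morphism generates the unit ideal of its domain with x
   adjoined: a relation 1 + p_0 + p_1 x + ... = 0 with every p_i in the kernel. *)
Definition place_obstructed (S : K -> F -> Prop) (x : K) : Prop :=
  exists P, place_lift S P 1 /\ root P x.

(** The reductions of polynomials vanishing at [x] form an ideal of [F[X]], proper when [x] is not
    obstructed. As [F] is algebraically closed, the ideal has a common root [c], and [x] can be sent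
    to [c]. *)
Lemma place_adjoin S x : partial_place S -> ~ place_obstructed S x ->
  exists S', [/\ partial_place S', forall u a, S u a -> S' u a & exists c, S' x c].
Proof.
move=> pS nobs.
pose J Q := exists P, place_lift S P Q /\ root P x.
have J_sub Q R A : J Q -> J R -> J (Q - A * R).
  move=> [P [SP Px]] [P' [SP' Px']].
  exists (P + map_poly iota (- A) * P'); split.
    rewrite -mulNr; apply: place_liftD => //.
    by apply: place_liftM => //; apply: place_lift_map.
  by rewrite /root hornerD hornerM (rootP Px) (rootP Px') mulr0 addr0.
have [c Jc] : exists c, forall Q, J Q -> root Q c.
  suff [R [JR R1 Rdvd]] : exists R, [/\ J R, size R != 1%N & forall Q, J Q -> R %| Q].
    have [c Rc] := closed_rootP R R1.
    by exists c => Q /Rdvd; rewrite -!dvdp_XsubCl in Rc *; apply: dvdp_trans.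
  (* The zero ideal has generator 0, whose size also differs from 1. *)
  have [J0|Jn0] := classic (forall Q, J Q -> Q = 0).
    exists 0; split; rewrite ?size_poly0 //; last by move=> Q /J0->; rewrite dvd0p.
    exists 0; split; last exact: root0.
    by move=> i; rewrite !coef0; apply: place0.
  have [Q0 Q0n] := not_all_ex_not _ _ Jn0; have {Q0n}[] := imply_to_and _ _ Q0n.
  (* Descent on size: an element of [J] that does not divide all of [J] leaves a smaller non-zero
     remainder in [J]. *)
  have [n] := ubnP (size Q0); elim: n Q0 => [|n IH] Q0; first by rewrite ltn0.
  move=> ltQ0 JQ0 /eqP Q0_neq0.
  have [Rdvd|ndvd] := classic (forall Q, J Q -> Q0 %| Q).
    (* A generator equal to a non-zero constant [c] would, after scaling by [c^-1], yield an
       obstruction. *)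
    exists Q0; split => //; apply/negP => /size_poly1P[c c0 Q0E].
    apply: nobs; have [P [SP Px]] := JQ0.
    exists ((iota c^-1)%:P * P); split; last by rewrite /root hornerM (rootP Px) mulr0.
    rewrite -polyC1 -(mulVf c0) polyCM -Q0E; apply: place_liftM => //.
    by apply: place_liftC => //; apply: place_const.
  have [Q Qn] := not_all_ex_not _ _ ndvd; have [JQ Q0Q] := imply_to_and _ _ Qn.
  apply: (IH (Q %% Q0)); last by move/eqP/Q0Q.
    by rewrite -ltnS (leq_trans _ ltQ0) // ltnS ltn_modp.
  have -> : Q %% Q0 = Q - (Q %/ Q0) * Q0 by apply/eqP; rewrite eq_sym subr_eq addrC -divp_eq.
  exact: J_sub.
exists (fun u a => exists P Q, [/\ place_lift S P Q, u = P.[x] & a = Q.[c]]).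
split; [split|..].
- move=> b; exists (iota b)%:P, b%:P; rewrite !hornerC; split=> //.
  by apply: place_liftC => //; apply: place_const.
- move=> _ _ _ _ [P [Q [SP -> ->]]] [P' [Q' [SP' -> ->]]].
  by exists (P + P'), (Q + Q'); rewrite !hornerD; split=> //; apply: place_liftD.
- move=> _ _ _ _ [P [Q [SP -> ->]]] [P' [Q' [SP' -> ->]]].
  by exists (P * P'), (Q * Q'); rewrite !hornerM; split=> //; apply: place_liftM.
(* Well-definedness: if [P.[x] = 0], then [Q] is in [J], so [Q.[c] = 0]. *)
- move=> a [P [Q [SP Px ->]]]; apply/rootP/Jc; exists P; split=> //.
  exact/rootP/esym.
- by move=> u a Su; exists u%:P, a%:P; rewrite !hornerC; split=> //; apply: place_liftC.
- exists c, 'X, 'X; rewrite !hornerX; split=> // i; rewrite !coefX.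
  by case: eqP => _; [apply: place1 | apply: place0].
Qed.

(* Subtracting a multiple of the relation for 1/x from the relation for x cancels
   the leading term of the latter and keeps its constant term in 1 + kernel. *)
Lemma place_obstructed_size S x P P' :
    partial_place S -> x != 0 -> place_lift S P 1 -> place_lift S P' 1 ->
    root P x -> root P' x^-1 -> (size P' <= size P)%N ->
  exists R, [/\ place_lift S R 1, root R x & (size R < size P)%N].
Proof.
move=> pS x0 SP SP' Px P'x leP.
(* Sizes 0 and 1 are impossible: the constant coefficient would be 0, yet reduce to 1. *)
case defn : (size P) => [|n].
  have := SP 0%N; rewrite (eqP (_ : P == 0)) -?size_poly_eq0 ?defn // coef0 coef1 => /(place_functional pS).
  by move/eqP; rewrite oner_eq0.
case: n defn => [|n] defn.
  have P0 : P`_0 = 0 by have := rootP Px; rewrite (size1_polyC (eq_leq defn)) hornerC coefC.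
  have := SP 0%N; rewrite P0 coef1 => /(place_functional pS).
  by move/eqP; rewrite oner_eq0.
(* The second product comes from the reversed polynomial [x ^+ n.+1 * P'.[x^-1]], which is zero; the
   difference cancels at index [n.+1]. *)
pose r i := P'`_0 * P`_i - P`_n.+1 * P'`_(n.+1 - i).
exists (\poly_(i < n.+1) r i); split; last by rewrite ltnS size_poly.
  move=> i; rewrite coef_poly coef1; case: ltnP => [lt_in|le_ni]; last first.
    by case: i le_ni => // i _; apply: place0.
  (* The two multipliers reduce to 1 and 0, so the combination still reduces to 1. *)
  have -> : (i == 0%N)%:R = 1 * (i == 0%N)%:R - 0 * (n.+1 - i == 0)%N%:R :> F.
    by rewrite mul1r mul0r subr0.
  have S0 := SP' 0%N; have Sn := SP n.+1; have Si := SP i; have Sni := SP' (n.+1 - i)%N.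
  rewrite !coef1 /= in S0 Sn Si Sni.
  by apply: placeB => //; apply: placeM.
apply/rootP; rewrite horner_poly.
have rn0 : r n.+1 = 0 by rewrite /r subnn mulrC subrr.
have -> : \sum_(i < n.+1) r i * x ^+ i = \sum_(i < n.+2) r i * x ^+ i.
  by rewrite [RHS]big_ord_recr /= rn0 mul0r addr0.
under eq_bigr => i _ do rewrite mulrBl -mulrA -[X in _ - X]mulrA.
rewrite sumrB -!mulr_sumr.
have -> : \sum_(i < n.+2) P`_i * x ^+ i = 0.
  by rewrite -[RHS](rootP Px) horner_coef defn.
suff -> : \sum_(i < n.+2) P'`_(n.+1 - i) * x ^+ i = 0 by rewrite !mulr0 subrr.
rewrite (reindex_inj rev_ord_inj) /=.
transitivity (x ^+ n.+1 * P'.[x^-1]); last by rewrite (rootP P'x) mulr0.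
have leP2 : (size P' <= n.+2)%N by rewrite -defn.
rewrite (horner_coef_wide _ leP2) mulr_sumr.
apply: eq_bigr => i _; have le_in : (i <= n.+1)%N by rewrite -ltnS.
rewrite subSS subKn // mulrCA; congr (_ * _).
have -> : x ^+ n.+1 = x ^+ (n.+1 - i) * x ^+ i by rewrite -exprD subnK.
by rewrite exprVn mulfK ?expf_neq0.
Qed.

(** Given obstructions for [x] and [x^-1], one of largest size can be shortened, so the sum of the
    sizes would descend forever. *)
Lemma place_obstructedV S x :
  partial_place S -> x != 0 -> place_obstructed S x -> ~ place_obstructed S x^-1.
Proof.
move=> pS + [P [SP Px]] [P' [SP' P'x]].
have [n] := ubnP (size P + size P').
elim: n x P P' SP SP' Px P'x => [|n IH] x P P' SP SP' Px P'x; first by rewrite ltn0.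
move=> lt_n x0.
have [leP|/ltnW leP] := leqP (size P') (size P).
  have [R [SR Rx ltR]] := place_obstructed_size pS x0 SP SP' Px P'x leP.
  apply: (IH x R P') => //; by rewrite -ltnS; apply: leq_ltn_trans lt_n; rewrite ltn_add2r.
rewrite -[x]invrK in Px; have xV0 : x^-1 != 0 by rewrite invr_eq0.
have [R [SR Rx ltR]] := place_obstructed_size pS xV0 SP' SP P'x Px leP.
apply: (IH x P R) => //; first by rewrite -[x]invrK.
by rewrite -ltnS; apply: leq_ltn_trans lt_n; rewrite ltn_add2l.
Qed.

(** One step of Chevalley's extension theorem: [x] and [x^-1] are not both obstructed. *)
Lemma place_extend S x : partial_place S -> x != 0 ->
  exists S', [/\ partial_place S', forall u a, S u a -> S' u a
    & exists c, S' x c \/ S' x^-1 c].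
Proof.
move=> pS x0; have [obs|nobs] := classic (place_obstructed S x).
  have [S' [pS' SS' [c Sc]]] := place_adjoin pS (place_obstructedV pS x0 obs).
  by exists S'; split=> //; exists c; right.
have [S' [pS' SS' [c Sc]]] := place_adjoin pS nobs.
by exists S'; split=> //; exists c; left.
Qed.

(** A pivot [y] for the tail is kept if [x / y] can be adjoined; if [y / x] is adjoined instead, [x]
    becomes the pivot, as [z / x = (z / y) * (y / x)]. *)
Lemma place_extend_ratios S (s : seq K) :
    partial_place S -> s != [::] -> all (fun x => x != 0) s ->
  exists S', [/\ partial_place S', forall u a, S u a -> S' u a
    & exists2 y, y \in s & forall z, z \in s -> exists c, S' (z / y) c].
Proof.
move=> pS; elim: s => // x s IH _ /= /andP[x0 s0].
have [->|sN] := eqVneq s [::].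
  exists S; split=> //; exists x; first exact: mem_head.
  by move=> z; rewrite inE => /eqP->; exists 1; rewrite divff //; apply: place1.
have [S1 [pS1 SS1 [y ys Sy]]] := IH sN s0.
have y0 : y != 0 := allP s0 y ys.
have [|S2 [pS2 SS2 [c Sc]]] := @place_extend S1 (x / y) pS1.
  by rewrite mulf_neq0 ?invr_eq0.
exists S2; split=> //; first by move=> u a /SS1/SS2.
case: Sc => Sc.
  exists y; rewrite ?inE ?ys ?orbT // => z; rewrite inE => /orP[/eqP->|/Sy[b Sb]].
    by exists c.
  by exists b; apply: SS2.
exists x; rewrite ?mem_head // => z; rewrite inE => /orP[/eqP->|/Sy[b Sb]].
  by exists 1; rewrite divff //; apply: place1.
exists (b * c); have -> : z / x = (z / y) * (x / y)^-1 by field; rewrite x0 y0.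
by apply: (placeM pS2) => //; apply: SS2.
Qed.

End Places.

(** * Systems of quadratic equations *)

Section QuadraticSystem.
Variables (F : closedFieldType) (K : fieldType) (iota : {rmorphism F -> K}).
Variables (I : finType) (r : nat) (A : 'I_r -> I -> I -> F) (x : I -> K).
Hypothesis x_neq0 : forall i, x i != 0.

Let f l := \sum_i \sum_j iota (A l i j) * x i * x j.

(** The hypothesis is well-definedness of the morphism killing every [f l / x i ^+ 2]: relations
    among these have zero constant term. *)
Lemma quadratic_zero_of_place (i : I) :
    (forall P : {mpoly F[r]}, mmap iota (fun l => f l / x i ^+ 2) P = 0 ->
       P.@[fun=> 0] = 0) ->
  exists z : I -> F, (exists j, z j != 0) /\
    forall l, \sum_j \sum_k A l j k * z j * z k = 0.
Proof.
move=> functional; set g := fun l => f l / x i ^+ 2 in functional.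
pose S u v := exists P : {mpoly F[r]}, u = mmap iota g P /\ v = P.@[fun=> 0].
have pS : partial_place iota S.
  split.
  - by move=> c; exists c%:MP; rewrite mmapC mevalC.
  - by move=> _ _ _ _ [P [-> ->]] [Q [-> ->]]; exists (P + Q); rewrite mmapD mevalD.
  - by move=> _ _ _ _ [P [-> ->]] [Q [-> ->]]; exists (P * Q); rewrite !rmorphM.
  - by move=> _ [P [/esym/functional ? ->]].
have Sg l : S (g l) 0 by exists 'X_l; rewrite mmapX mmap1U mevalXU.
have [||S' [pS' SS' [_ /mapP[j _ ->] Sxj]]] := @place_extend_ratios _ _ _ S [seq x k | k : I] pS.
- by rewrite -size_eq0 size_map -cardE -lt0n; apply/card_gt0P; exists i.
- by apply/allP => _ /mapP[k _ ->].
have uniqS u a b : S' u a -> S' u b -> a = b.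
  move=> Sa Sb; apply/eqP; rewrite -subr_eq0; apply/eqP/(place_functional pS').
  by rewrite -(subrr u); apply: (placeB pS').
have [z Sz] := fin_all_exists (fun k => Sxj (x k) (image_f x (isT : k \in I))).
exists z; split.
  exists j; have := Sz j; rewrite divff // => Szj.
  by rewrite (uniqS _ _ _ Szj (place1 pS')) oner_neq0.
(* This element is [f l / x j ^+ 2]: its factor [g l] sends it to 0, its expansion to the value of
   the form at [z]. *)
move=> l; apply: (uniqS (g l * (x i / x j) ^+ 2)); last first.
  rewrite -(mul0r (z i ^+ 2)); apply: (placeM pS'); first exact: SS'.
  by rewrite !expr2; apply: (placeM pS').
have -> : g l * (x i / x j) ^+ 2 =
    \sum_a \sum_b iota (A l a b) * (x a / x j) * (x b / x j).
  rewrite /g /f expr_div_n mulrA divfK ?expf_neq0 // mulr_suml.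
  apply: eq_bigr => a _; rewrite mulr_suml; apply: eq_bigr => b _.
  by field; apply: x_neq0.
apply: (place_sum _ pS') => a; apply: (place_sum _ pS') => b.
by do 2!apply: (placeM pS') => //; apply: place_const pS' _.
Qed.

(** Clearing denominators turns the relation into an integral equation for [x i]: the constant term
    carries the top power, every other monomial a lower one. *)
Lemma integral_of_no_place (i : I) (P : {mpoly F[r]}) :
    mmap iota (fun l => f l / x i ^+ 2) P = 0 -> P.@[fun=> 0] != 0 ->
  exists E D, (0 < E)%N /\
    lspan iota (fun y => exists a : 'I_r -> nat, exists j,
      [/\ forall l, (a l <= D)%N, (j < E)%N
        & y = (\prod_l f l ^+ a l) * x i ^+ j]) (x i ^+ E).
Proof.
have -> : P.@[fun=> 0] = P@_0%MM.
  pose c (p : {mpoly F[r]}) := p.@[fun=> 0].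
  rewrite [X in X.@[_]]mpolyE raddf_sum /= [in RHS](mpolyE P) raddf_sum /=.
  apply: eq_bigr => m _; rewrite mevalZ mevalX mcoeffZ mcoeffX; congr (_ * _).
  have [->|m0] := eqVneq m 0%MM; first by rewrite big1 // => l _; rewrite mnm0E.
  have [l ml] : exists l, m l != 0%N.
    apply/existsP; apply: contraNT m0; rewrite negb_exists => /forallP m0.
    by apply/eqP/mnmP => l; rewrite mnm0E; apply/eqP; have := m0 l; rewrite negbK.
  by rewrite (bigD1 l) //= expr0n (negPf ml) mul0r.
move=> gP P0; pose M := msize P.
have M0 : (0 < M)%N.
  by rewrite (leq_ltn_trans _ (msize_mdeg_lt (m := 0%MM) _)) // mcoeff_msupp.
(* Monomials of [P] have degree below [M], so [x i ^+ (2 * M)] clears all denominators and no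
   exponent of [f l] exceeds [M]. *)
exists (2 * M)%N, M; split; first by rewrite muln_gt0.
have x2M : \sum_(m <- msupp P) iota P@_m *
    ((\prod_l f l ^+ m l) * x i ^+ (2 * M - 2 * mdeg m)) = 0.
  have := congr1 ( *%R^~ (x i ^+ (2 * M))) gP; rewrite mul0r /mmap mulr_suml => gPx.
  rewrite -[RHS]gPx.
  apply: eq_big_seq => m mP; rewrite -mulrA; congr (_ * _).
  have le_m : (2 * mdeg m <= 2 * M)%N by rewrite leq_mul2l ltnW ?orbT ?msize_mdeg_lt.
  have x2m : x i ^+ (2 * mdeg m) = \prod_l (x i ^+ 2) ^+ m l.
    by rewrite prodrXr -mdegE exprM.
  rewrite -[in RHS](subnK le_m) exprD x2m mulrCA /mmap1 mulrC -big_split /=.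
  congr (_ * _); apply: eq_bigr => l _.
  by rewrite -exprMn divfK ?expf_neq0.
rewrite (bigD1_seq 0%MM) ?msupp_uniq ?mcoeff_msupp //= mdeg0 muln0 subn0 in x2M.
rewrite big1 ?mul1r in x2M; last by move=> l _; rewrite mnm0E.
have -> : x i ^+ (2 * M) = iota (- (P@_0%MM)^-1) *
    \sum_(m <- msupp P | m != 0%MM) iota P@_m *
      (\prod_l f l ^+ m l * x i ^+ (2 * M - 2 * mdeg m)).
  move/eqP: x2M; rewrite addrC addr_eq0 => /eqP->.
  by rewrite rmorphN mulrNN mulrA -rmorphM mulVf // rmorph1 mul1r.
apply: lspanZ; rewrite big_seq_cond; apply: lspan_sum => m /andP[mP m0]; apply: lspanZ.
have lt_m := msize_mdeg_lt mP.
apply: lspan_gen; exists m, (2 * M - 2 * mdeg m)%N; split=> //.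
  by move=> l; rewrite (leq_trans _ (ltnW lt_m)) // mdegE (bigD1 l) //= leq_addr.
by rewrite -mulnBr ltn_mul2l /= ltn_subrL lt0n mdeg_eq0 m0.
Qed.

End QuadraticSystem.

Lemma word_of_exponents (K : fieldType) (I : finType) (c : I -> nat) (y : I -> K) :
  exists2 w : seq I, size w = (\sum_i c i)%N & \prod_i y i ^+ c i = \prod_(i <- w) y i.
Proof.
pose p n z := exists2 w : seq I, size w = n & z = \prod_(i <- w) y i.
apply: (big_ind2 p) => [|m z n t [u <- ->] [v <- ->]|i _].
- by exists [::]; rewrite ?big_nil.
- by exists (u ++ v); rewrite ?size_cat ?big_cat.
- exists (nseq (c i) i); first exact: size_nseq.
  by rewrite big_nseq -Monoid.iteropE.
Qed.

(** Without a zero, all [x i] are integral over the algebra generated by [r] forms, so their words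
    of length [n] span a space of dimension O(n^r), too small for the monomials in [s > r]
    variables. *)
Lemma quadratic_system_ord (F : closedFieldType) (r s : nat)
    (A : 'I_r -> 'I_s -> 'I_s -> F) : (r < s)%N ->
  exists z : 'I_s -> F, (exists j, z j != 0) /\
    forall l, \sum_j \sum_k A l j k * z j * z k = 0.
Proof.
move=> lt_rs; apply: NNPP => nozero.
pose toK : {rmorphism {mpoly F[s]} -> {fraction {mpoly F[s]}}} := @FracField.tofrac _.
pose iota : {rmorphism F -> {fraction {mpoly F[s]}}} := toK \o @mpolyC s F.
pose x (i : 'I_s) := toK 'X_i.
have x_neq0 i : x i != 0.
  rewrite /x tofrac_eq0; apply/eqP => /(congr1 (mcoeff U_(i))).
  by rewrite mcoeffX eqxx mcoeff0; apply/eqP/oner_neq0.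
have /fin_all_exists[E /fin_all_exists[D ED]] (i : 'I_s) :
    exists E D, (0 < E)%N /\
    lspan iota (fun y => exists a : 'I_r -> nat, exists j,
      [/\ forall l, (a l <= D)%N, (j < E)%N
        & y = (\prod_l (\sum_i \sum_j iota (A l i j) * x i * x j) ^+ a l) * x i ^+ j])
      (x i ^+ E).
  apply: NNPP => nint; apply: nozero.
  apply: (quadratic_zero_of_place (iota := iota) x_neq0 (i := i)) => P gP.
  by apply: NNPP => /eqP P0; apply: nint; apply: integral_of_no_place gP P0.
have E_gt0 i := (ED i).1; have x_int i := (ED i).2.
have [C [d growth]] := indep_growth x_int E_gt0.
(* Chosen so that [(s * n * d).+1 ^ r * C < n ^ r.+1 <= n ^ s]. *)
pose n := (C * (s * d).+1 ^ r).+1.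
pose e (c : {ffun 'I_s -> 'I_n}) := \prod_i x i ^+ c i.
have e_indep : indep iota e.
  move=> c sum0 i.
  have eE k : e k = toK 'X_[[multinom (k j : nat) | j < s]].
    rewrite mpolyXE_id rmorph_prod; apply: eq_bigr => j _.
    by rewrite rmorphXn mnmE.
  have : toK (\sum_k c k *: 'X_[[multinom (k j : nat) | j < s]]) = 0.
    rewrite -[RHS]sum0 rmorph_sum; apply: eq_bigr => k _.
    by rewrite -mul_mpolyC rmorphM eE.
  move/eqP; rewrite tofrac_eq0 => /eqP /(congr1 (mcoeff [multinom (i j : nat) | j < s])).
  rewrite mcoeff0 raddf_sum (bigD1 i) //= mcoeffZ mcoeffX eqxx mulr1 big1 ?addr0 //.
  move=> k ki; rewrite mcoeffZ mcoeffX; case: eqP => [/mnmP E0|_]; last exact: mulr0.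
  case/eqP: ki; apply/ffunP => j; apply/val_inj.
  by have := E0 j; rewrite !mnmE.
have leq_expn a b q : (a <= b -> a ^ q <= b ^ q)%N by case: q => // q; rewrite leq_exp2r.
have : (n ^ s <= (s * n * d).+1 ^ r * C)%N.
  have := growth (s * n)%N _ e e_indep; rewrite card_ffun !card_ord; apply=> c.
  apply: lspan_gen; have [w wc wx] := word_of_exponents (fun i => c i) x.
  exists w => //; rewrite wc -[X in (X * _)%N]card_ord -sum_nat_const.
  by apply: leq_sum => i _; apply/ltnW/ltn_ord.
apply/negP; rewrite -ltnNge.
have le_n : ((s * n * d).+1 <= n * (s * d).+1)%N.
  by rewrite mulnS mulnAC [(n * (s * d))%N]mulnC -addn1 addnC leq_add2r.
apply: (@leq_ltn_trans (n ^ r * (C * (s * d).+1 ^ r))).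
  by rewrite mulnCA [X in (_ <= X)%N]mulnC -expnMn leq_mul2r leq_expn ?orbT.
have -> : (n ^ s = n ^ r * n ^ (s - r.+1).+1)%N by rewrite -expnD -addSnnS subnKC.
rewrite ltn_pmul2l ?expn_gt0 //.
by rewrite expnS -/n; apply: (leq_pmulr n); rewrite expn_gt0.
Qed.

Lemma quadratic_system (F : closedFieldType) (I J : finType)
    (A : J -> I -> I -> F) : (#|J| < #|I|)%N ->
  exists z : I -> F, (exists i, z i != 0) /\
    forall l, \sum_i \sum_j A l i j * z i * z j = 0.
Proof.
move=> ltJI.
have [z [[i zi] Az]] := quadratic_system_ord
  (fun l i j => A (enum_val l) (enum_val i) (enum_val j)) ltJI.
exists (z \o enum_rank); split; first by exists (enum_val i); rewrite /= enum_valK.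
move=> l; rewrite -[RHS](Az (enum_rank l)) enum_rankK.
rewrite (reindex _ (onW_bij _ (enum_val_bij I))); apply: eq_bigr => a _.
rewrite (reindex _ (onW_bij _ (enum_val_bij I))); apply: eq_bigr => b _.
by rewrite /= !enum_valK.
Qed.

(** * Growth of algebraic extensions of F(t) *)

Section AlgebraicGrowth.
Variables (F k : fieldType) (iota : {rmorphism F -> k}) (t : k).

Let ev (p : {poly F}) : k := (map_poly iota p).[t].

Let evM p q : ev (p * q) = ev p * ev q.
Proof. by rewrite /ev rmorphM hornerM. Qed.

Let evN p : ev (- p) = - ev p.
Proof. by rewrite /ev rmorphN hornerN. Qed.

Let ev_prod (I : Type) (r : seq I) (P : pred I) (p : I -> {poly F}) :
  ev (\prod_(i <- r | P i) p i) = \prod_(i <- r | P i) ev (p i).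
Proof. by rewrite /ev rmorph_prod horner_prod. Qed.

Let evX p n : ev (p ^+ n) = ev p ^+ n.
Proof. by rewrite /ev rmorphXn horner_exp. Qed.

(** Multiplying by all the denominators moves the coefficients into [F[t]] and keeps the leading one
    non-zero. *)
Lemma algebraic_cleared w : algebraic_over_adjoin iota t w ->
  exists n (c : 'I_n.+1 -> {poly F}),
    [/\ (0 < n)%N, ev (c ord_max) != 0 & \sum_j ev (c j) * w ^+ j = 0].
Proof.
move=> [p [p0 pt pw]].
have [n defn] : exists n, size p = n.+1.
  by exists (size p).-1; rewrite prednK // size_poly_gt0.
have n_gt0 : (0 < n)%N.
  rewrite lt0n; apply/eqP => n0; move: pw p0; rewrite n0 in defn.
  rewrite (size1_polyC (eq_leq defn)) /root hornerC polyC_eq0 => ->//.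
have [a /fin_all_exists[b ab]] := fin_all_exists (fun j : 'I_n.+1 => pt j).
exists n, (fun j => a j * \prod_(i | i != j) b i).
have cE j : ev (a j * \prod_(i | i != j) b i) = p`_j * \prod_i ev (b i).
  have [bj ->] := ab j; rewrite evM ev_prod [in RHS](bigD1 j) //= mulrA; congr (_ * _).
  by rewrite divfK.
split=> //.
  rewrite cE mulf_neq0 //=; last by apply/prodf_neq0 => i _; case: (ab i).
  by have := p0; rewrite -lead_coef_eq0 lead_coefE defn.
under eq_bigr => j _ do rewrite cE mulrAC.
rewrite -mulr_suml; suff -> : \sum_(j < n.+1) p`_j * w ^+ j = 0 by rewrite mul0r.
by rewrite -[RHS](rootP pw) horner_coef defn.
Qed.

Lemma lspan_ev (p : {poly F}) u D : (size p <= D)%N ->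
  lspan iota (fun x => exists2 a, (a <= D)%N & x = t ^+ a * u) (ev p * u).
Proof.
move=> leD; rewrite /ev horner_coef mulr_suml; apply: lspan_sum => i _.
rewrite coef_map -mulrA; apply: lspanZ; apply: lspan_gen; exists i => //.
by rewrite (leq_trans (ltnW (ltn_ord i))) // (leq_trans _ leD) // size_map_poly.
Qed.

(** Multiplying [w i] by the leading coefficient of its relation makes it integral over [F[t]]; the
    product of these coefficients works for all [i] at once. ['I_1] indexes the single generator
    [t]. *)
Lemma common_integral_multiplier (I : finType) (w : I -> k) :
    (forall i, algebraic_over_adjoin iota t (w i)) ->
  exists G, G != 0 /\ forall i, exists E D, (0 < E)%N /\
    lspan iota (fun x => exists a : 'I_1 -> nat, exists j,
      [/\ forall l, (a l <= D)%N, (j < E)%N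
        & x = (\prod_l t ^+ a l) * (G * w i) ^+ j]) ((G * w i) ^+ E).
Proof.
move=> alg.
have {alg}[n /fin_all_exists[c nc]] := fin_all_exists (fun i => algebraic_cleared (alg i)).
pose g i := c i ord_max; pose G := \prod_i g i.
exists (ev G); split.
  by rewrite ev_prod; apply/prodf_neq0 => i _; case: (nc i).
move=> i; have [n0 gi0 sum0] := nc i.
pose h := \prod_(j | j != i) g j.
have GE : G = g i * h by rewrite /G (bigD1 i).
(* Below the top degree, these are the coefficients after multiplying the relation by
   [h * G ^+ (n i).-1], which makes its leading term [(G * w i) ^+ n i]. *)
pose q (j : 'I_(n i).+1) := h * c i j * G ^+ ((n i).-1 - j).
exists (n i), (\max_j size (q j)); split=> //.
have -> : (ev G * w i) ^+ n i =
    \sum_(j < n i) ev (- q (widen_ord (leqnSn _) j)) * (ev G * w i) ^+ j.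
  move: sum0; rewrite big_ord_recr /= addrC => /eqP; rewrite addr_eq0 => /eqP sum0.
  transitivity (ev G ^+ (n i).-1 * ev h * (ev (g i) * w i ^+ n i)).
    have evG : ev G = ev (g i) * ev h by rewrite GE evM.
    by rewrite exprMn -{1 3}(prednK n0) !exprS {1}evG; ring.
  rewrite sum0 mulrN mulr_sumr -sumrN; apply: eq_bigr => j _.
  have le_j : (j <= (n i).-1)%N by rewrite -ltnS prednK.
  rewrite -{1}(subnK le_j) exprD exprMn evN /q !evM evX /=.
  ring.
apply: lspan_sum => j _.
have le_q : (size (- q (widen_ord (leqnSn _) j)) <= \max_j size (q j))%N.
  by rewrite size_polyN; apply: leq_bigmax.
apply: lspan_trans (lspan_ev _ le_q) => _ [a le_a ->]; apply: lspan_gen; exists (fun=> a), j; split=> //.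
by rewrite big_ord1.
Qed.

(* Multiplying words of length n by G^n makes their letters integral over F[t]. *)
Lemma algebraic_word_growth (I : finType) (w : I -> k) :
    (forall i, algebraic_over_adjoin iota t (w i)) ->
  exists C, forall n (N : finType) (e : N -> k), indep iota e ->
    (forall i, lspan iota (fun x => exists2 s : seq I, size s = n &
       x = \prod_(i <- s) w i) (e i)) ->
  (#|N| <= C * n.+1)%N.
Proof.
move=> /common_integral_multiplier[G [G0 /fin_all_exists[E /fin_all_exists[D ED]]]].
have [C [d growth]] := indep_growth (fun i => (ED i).2) (fun i => (ED i).1).
exists (C * d.+1)%N => n N e e_indep eW.
have := growth n N (fun i => G ^+ n * e i); rewrite card_ord expn1 => le_N.
apply: leq_trans (le_N _ _) _.
- move=> c sum0; apply: e_indep; apply: (mulfI (expf_neq0 n G0)); rewrite mulr0 -[RHS]sum0.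
  by rewrite mulr_sumr; apply: eq_bigr => i _; rewrite mulrCA.
- move=> i; rewrite mulrC; apply: lspanMr (eW i) => _ [s sn ->].
  apply: lspan_gen; exists s; first by rewrite sn.
  by rewrite big_split /= big_const_seq iter_mulr_1 count_predT sn mulrC.
rewrite mulnC -mulnA leq_mul2l; apply/orP; right.
by rewrite mulSn mulnS addSn ltnS mulnC addnA leq_addl.
Qed.

End AlgebraicGrowth.

(** * Isotropic vectors *)

Section Basis.
Variables (F K : fieldType) (iota : {rmorphism F -> K}).

Lemma indep_extend d (e : 'I_d -> K) x : indep iota e ->
    ~ lspan iota (fun y => exists i, y = e i) x ->
  indep iota (fun i : 'I_d.+1 => oapp e x (unlift ord0 i)).
Proof.
move=> inde xe c; rewrite big_ord_recl unlift_none /=.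
under eq_bigr => i _ do rewrite liftK /=.
have [c0|c0] := eqVneq (c ord0) 0.
  rewrite c0 rmorph0 mul0r add0r => /inde ce i.
  by case: (unliftP ord0 i) => [j|] ->; first exact: ce.
move/eqP; rewrite addr_eq0 => /eqP cx; case: xe.
have -> : x = iota (c ord0)^-1 * (iota (c ord0) * x).
  by rewrite mulrA -rmorphM mulVf // rmorph1 mul1r.
rewrite cx; apply/lspanZ/lspanN/lspan_sum => i _; apply: lspanZ.
by apply: lspan_gen; exists i.
Qed.

(** Otherwise every independent family could be lengthened, past the bound [B]. *)
Lemma lspan_basis (G : K -> Prop) (B : nat) :
    (forall d (e : 'I_d -> K), indep iota e -> (forall i, lspan iota G (e i)) -> (d <= B)%N) ->
  exists d (e : 'I_d -> K), [/\ indep iota e, forall i, lspan iota G (e i)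
    & forall x, lspan iota G x -> lspan iota (fun y => exists i, y = e i) x].
Proof.
move=> bound; apply: NNPP => nobasis.
suff all d : exists e : 'I_d -> K, indep iota e /\ forall i, lspan iota G (e i).
  by have [e [inde eG]] := all B.+1; have := bound _ e inde eG; rewrite ltnn.
elim: d => [|d [e [inde eG]]]; first by exists (fun=> 0); split=> [c _|] [].
have [x [Gx xe]] : exists x, lspan iota G x /\ ~ lspan iota (fun y => exists i, y = e i) x.
  apply: NNPP => nox; apply: nobasis; exists d, e; split=> // x Gx.
  by apply: NNPP => xe; apply: nox; exists x.
exists (fun i : 'I_d.+1 => oapp e x (unlift ord0 i)); split; first exact: indep_extend.
by move=> i; case: unliftP => [j|] _ /=.
Qed.

End Basis.

(** Bernoulli's inequality [1 + j / 2 <= (3 / 2) ^ j], taken at [j = 2 * C]. *)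
Lemma expn2_expn3_unbounded C : exists j, (C * 2 ^ j < 3 ^ j)%N.
Proof.
exists (2 * C)%N.
have bound j : ((j + 2) * 2 ^ j <= 2 * 3 ^ j)%N.
  elim: j => // j IH; rewrite expnS [(3 ^ _)%N]expnS [(2 * (3 * _))%N]mulnCA.
  apply: leq_trans (leq_mul (leqnn 3) IH); rewrite !mulnA leq_mul2r.
  by rewrite addSn mulSn [(3 * _)%N]mulSn [(2 * _)%N]mulnC leq_add2r leq_addl orbT.
rewrite -(ltn_pmul2l (isT : 0 < 2)%N); apply: leq_trans (bound _).
rewrite mulnA ltn_pmul2r ?expn_gt0 //.
by rewrite addn2 ltnS leqnSn.
Qed.

(** * Hermitian forms in three variables *)

Section HermitianZero.
Variables (F : closedFieldType) (k : fieldType) (iota : {rmorphism F -> k}).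
Variables (t : k) (conj : {rmorphism k -> k}) (h : 'I_3 -> 'I_3 -> k).
Hypothesis k_algebraic : forall x, algebraic_over_adjoin iota t x.
Hypothesis conj_iota : forall a, conj (iota a) = iota a.
Hypothesis h_herm : forall i j, conj (h i j) = h j i.

(** The letter [None] stands for 1, so words of length exactly [n] also cover shorter products. *)
Let w (o : option ('I_3 * 'I_3)) : k := if o is Some p then h p.1 p.2 else 1.
Let U n := lspan iota (fun x => exists2 s : seq (option ('I_3 * 'I_3)), size s = n &
  x = \prod_(i <- s) w i).

Let U_conj n x : U n x -> U n (conj x).
Proof.
elim=> [|c _ v [s sn ->] _ IH]; first by rewrite rmorph0; left.
rewrite rmorphD rmorphM conj_iota; apply: lspanD => //; apply/lspanZ/lspan_gen.
exists [seq if o is Some p then Some (p.2, p.1) else None | o <- s].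
  by rewrite size_map.
rewrite big_map rmorph_prod; apply: eq_bigr => -[[i j]|] _ /=; first exact: h_herm.
exact: rmorph1.
Qed.

Let U_mul n m x y : U n x -> U m y -> U (n + m) (x * y).
Proof.
apply: lspanM => _ _ [s sn ->] [s' sm ->]; apply: lspan_gen; exists (s ++ s').
  by rewrite size_cat sn sm.
by rewrite big_cat.
Qed.

Let U_h i j : U 1 (h i j).
Proof. by apply: lspan_gen; exists [:: Some (i, j)]; rewrite ?big_seq1. Qed.

(** Unknowns in [F] are fixed by [conj], so the value expands with coefficients in [U (n + n).+1]:
    one [n] for each vector and 1 for [h]. Coordinates along [e'] give [d'] quadratic forms in
    [3 * d] unknowns. *)
Lemma hermitian_zero_of_dims n d d' (e : 'I_d -> k) (e' : 'I_d' -> k) :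
    indep iota e -> (forall i, U n (e i)) ->
    (forall x, U (n + n).+1 x -> lspan iota (fun y => exists i, y = e' i) x) ->
    (d' < 3 * d)%N ->
  exists a : 'I_3 -> k, (exists i, a i != 0) /\
    \sum_i \sum_j a i * conj (a j) * h i j = 0.
Proof.
move=> inde eU Ue' lt_d.
have coef (p q : 'I_3 * 'I_d) : exists c : 'I_d' -> F,
    e p.2 * conj (e q.2) * h p.1 q.1 = \sum_l iota (c l) * e' l.
  apply/lspan_finite/Ue'; rewrite -addn1; apply: U_mul (U_h _ _).
  by apply: U_mul => //; apply: U_conj.
have [c cE] := fin_all_exists (fun p => fin_all_exists (coef p)).
have [|z [[[i0 b0] z0] zA]] := @quadratic_system F ('I_3 * 'I_d)%type 'I_d' (fun l p q => c p q l).
  by rewrite card_prod !card_ord.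
pose a i := \sum_b iota (z (i, b)) * e b.
exists a; split.
  exists i0; apply: contraNneq z0 => /inde z0; exact/eqP/z0.
transitivity (\sum_p \sum_q iota (z p * z q) * (e p.2 * conj (e q.2) * h p.1 q.1)).
  have pairE (f : 'I_3 * 'I_d -> k) : \sum_p f p = \sum_i \sum_b f (i, b).
    by rewrite pair_bigA; apply: eq_bigr => -[].
  rewrite pairE; apply: eq_bigr => i _.
  under [RHS]eq_bigr => b _ do rewrite pairE.
  rewrite [RHS]exchange_big; apply: eq_bigr => j _ /=.
  rewrite /a rmorph_sum -mulrA mulr_suml; apply: eq_bigr => b _.
  rewrite mulr_suml mulr_sumr; apply: eq_bigr => b' _.
  by rewrite !rmorphM conj_iota; ring.
under eq_bigr => p _ do under eq_bigr => q _ do rewrite cE mulr_sumr.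
under eq_bigr => p _ do rewrite exchange_big.
rewrite exchange_big big1 //= => l _.
transitivity (iota (\sum_p \sum_q c p q l * z p * z q) * e' l).
  rewrite rmorph_sum mulr_suml; apply: eq_bigr => p _.
  rewrite rmorph_sum mulr_suml; apply: eq_bigr => q _.
  by rewrite !rmorphM; ring.
by rewrite zA rmorph0 mul0r.
Qed.

(** Without a zero, the dimension at least triples from [U n] to [U (n + n).+1]; along
    [n = 2 ^ j - 1] it reaches [3 ^ j], against the bound [C * 2 ^ j]. *)
Lemma hermitian_zero3 : exists a : 'I_3 -> k, (exists i, a i != 0) /\
  \sum_i \sum_j a i * conj (a j) * h i j = 0.
Proof.
have [C growth] := algebraic_word_growth (fun o => k_algebraic (w o)).
have basis n : exists d (e : 'I_d -> k), [/\ indep iota e, forall i, U n (e i)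
    & forall x, U n x -> lspan iota (fun y => exists i, y = e i) x].
  apply: (lspan_basis (B := (C * n.+1)%N)) => d e inde eU.
  by rewrite -[d]card_ord; apply: growth inde eU.
apply: NNPP => nozero.
have [j] := expn2_expn3_unbounded C; apply/negP; rewrite -leqNgt.
suff [d [e [inde eU _ le_d]]] : exists d (e : 'I_d -> k), [/\ indep iota e,
    forall i, U (2 ^ j).-1 (e i),
    forall x, U (2 ^ j).-1 x -> lspan iota (fun y => exists i, y = e i) x & (3 ^ j <= d)%N].
  apply: leq_trans le_d _; have := growth _ _ e inde eU.
  by rewrite card_ord prednK ?expn_gt0.
elim: j => [|j [d [e [inde eU Ue le_d]]]].
  (* [U 0] contains 1, so its basis is not empty. *)
  have [d [e [inde eU Ue]]] := basis 0%N; exists d, e; split=> //.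
  have := @indep_leq_card _ _ iota _ _ (fun=> 1 : k) e; rewrite (card_ord d).
  move=> /(_ 'I_1); rewrite card_ord; apply.
    move=> c; rewrite big_ord1 mulr1 => /eqP; rewrite fmorph_eq0 => /eqP c0 i.
    by rewrite ord1.
  by move=> _; apply: Ue; apply: lspan_gen; exists [::]; rewrite ?big_nil.
have [d' [e' [inde' eU' Ue']]] := basis ((2 ^ j.+1).-1); exists d', e'; split=> //.
rewrite expnS (leq_trans (leq_mul (leqnn 3) le_d)) // leqNgt; apply/negP => lt_d.
apply: nozero; apply: hermitian_zero_of_dims inde eU _ lt_d => x.
suff -> : ((2 ^ j).-1 + (2 ^ j).-1).+1 = (2 ^ j.+1).-1 by apply: Ue'.
by rewrite expnS mul2n -addnn -[in RHS](prednK (_ : 0 < 2 ^ j)%N) ?expn_gt0 // addnS.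
Qed.

End HermitianZero.

Theorem corollary1
  (F : closedFieldType) (k : fieldType) (iota : {rmorphism F -> k})
  (htr : transcendence_degree_one iota)
  (conj : involutive_rmorphism k)
  (hconjF : forall a : F, conj (iota a) = iota a)
  (hconj : (exists x : k, conj x <> x) \/ 2%N \notin [pchar k])
  (V : vectType k) (form : {hermitian V for false & conj})
  (hdim : (3 <= \dim {:V})%N) :
  exists v : V, v <> 0 /\ form v v = 0.
Proof.
have [t [_ alg]] := htr.
(* Three independent vectors suffice: a non-trivial zero of their Gram form is the coordinate vector
   of an isotropic vector. *)
pose X := take 3 (vbasis {:V}).
have sizeX : size X == 3 by rewrite size_takel ?size_tuple.
have freeX : free (Tuple sizeX).
  have := basis_free (vbasisP {:V}); rewrite -{1}(cat_take_drop 3 (vbasis _)).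
  exact: catl_free.
have herm (i j : 'I_3) : conj (form X`_i X`_j) = form X`_j X`_i.
  by rewrite [RHS]hermC expr0 mul1r.
have [a [[i ai] a0]] := hermitian_zero3 alg hconjF herm.
exists (\sum_(i < 3) a i *: X`_i); split.
  by have /freeP indX := freeX; move/indX/(_ i)/eqP; rewrite (negPf ai).
rewrite linear_sumlz -[RHS]a0; apply: eq_bigr => j _.
rewrite linear_sumr; apply: eq_bigr => l _.
by rewrite linearZlr /= mulrA.
Qed.
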